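(* Let $a, b$ be integers satisfying $a \geq 0$, $b \geq 1$. Then for any positive integer $n$, $$H_n^*[\{2\}^a] = \sum_{k=1}^n \frac{1 + q^k}{[k]_q^{2a}} \frac{\begin{bmatrix} n \\ k \end{bmatrix}}{\begin{bmatrix} n+k \\ k \end{bmatrix}} (-1)^{k-1} q^{k(k-1)/2+ak},$$ $$H_n^*[\{2\}^a, 1] = \sum_{k=1}^n \frac{1 + q^k}{[k]_q^{2a+1}} \frac{\begin{bmatrix} n \\ k \end{bmatrix}}{\begin{bmatrix} n+k \\ k \end{bmatrix}} q^{k^2+ak},$$ $$H_n^*[\{2\}^a, 1, \{2\}^b] = - \sum_{k=1}^n \frac{1+q^k}{[k]_q^{2(a+b)+1}} \frac{\begin{bmatrix} n \\ k \end{bmatrix}}{\begin{bmatrix} n+k \\ k \end{bmatrix}} (-1)^k q^{k(k+1)/2+(a+b)k} - \sum_{k=1}^n \frac{1+q^k}{[k]_q^{2a+1}} \frac{\begin{bmatrix} n \\ k \end{bmatrix}}{\begin{bmatrix} n+k \\ k \end{bmatrix}} q^{k^2+ak} \sum_{j=1}^{k-1} \frac{(-1)^j (1+q^j) q^{bj-j(j+1)/2}}{[j]_q^{2b}}.$$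
   Context: Let $0<q<1$, $[n]_q = \frac{1-q^n}{1-q}$, $(q)_n=\prod_{k=0}^{n-1}(1-q^{k+1})$, and the Gaussian $q$-binomial coefficient $\begin{bmatrix} n \\ m \end{bmatrix} = \frac{(q)_n}{(q)_m (q)_{n-m}}$ for $0\le m\le n$, $0$ otherwise. For non-negative integer $n$ and $\mathbf{s}=(s_1,\dots,s_m)\in\mathbb{Z}^m$, the $q$-multiple harmonic star sum is $H_n^*[s_1,\dots,s_m] = \sum_{n \geq k_1 \geq \dots \geq k_m \geq 1} \prod_{j=1}^m \frac{q^{k_j}}{[k_j]_q^{s_j}}$, with $H_n^*[\emptyset]=1$. Here $\{2\}^a$ denotes the string $2,\dots,2$ ($a$ times). *)

(* Defs.v *)
From mathcomp Require Import all_boot all_order all_algebra.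

Set Implicit Arguments.
Unset Strict Implicit.
Unset Printing Implicit Defensive.

Import Order.TTheory GRing.Theory Num.Theory.
Local Open Scope ring_scope.

Definition qnum (R : fieldType) (q : R) (n : nat) : R := (1 - q ^+ n) / (1 - q).

Definition qpoch (R : fieldType) (q : R) (n : nat) : R :=
  \prod_(0 <= k < n) (1 - q ^+ k.+1).

Definition qbin (R : fieldType) (q : R) (n m : nat) : R :=
  if (m <= n)%N then qpoch q n / (qpoch q m * qpoch q (n - m)) else 0.

(* The summation index is the tuple (k_1, ..., k_m) of elements of {0, ..., n};
   the condition keeps those with n >= k_1 >= ... >= k_m >= 1. Since s consists
   of integers, the exponent in the denominator is an integer power. *)
Definition qHstar (R : fieldType) (q : R) (n : nat) (s : seq int) : R :=
  \sum_(k : (size s).-tuple 'I_n.+1 |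
          sorted (fun x y : 'I_n.+1 => (y <= x)%N) k
          && all (fun x : 'I_n.+1 => (1 <= x)%N) k)
    \prod_(j < size s) (q ^+ tnth k j / qnum q (tnth k j) ^ s`_j).

(* Main.v *)
(** Write c(n,k) for the ratio of the binomials [n,k] and [n+k,k]; it equals
    (q)_n^2 / ((q)_{n-k} (q)_{n+k}), vanishes for k > n, and satisfies
      c(n+1,k) - c(n,k) = q^{n+1}/[n+1]^2 * ([k]^2/q^k) * c(n+1,k).
    Since H*_{n+1}[e,s] - H*_n[e,s] = q^{n+1}/[n+1]^e * H*_{n+1}[s], prepending
    a 2 to s multiplies the k-th coefficient of an expansion
    H*_n[s] = sum_k A_k c(n,k) by q^k/[k]^2. This reduces the three formulas to
    the strings {}, {1} and {1,{2}^b}; in each of these the remaining identity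
    telescopes in k, thanks to c(n,k+1) (1 - q^{n+k+1}) = c(n,k) (1 - q^{n-k}). *)
Require Import Defs.
From mathcomp Require Import all_boot all_order all_algebra.
From mathcomp Require Import ring zify.

Set Implicit Arguments.
Unset Strict Implicit.
Unset Printing Implicit Defensive.

Import Order.TTheory GRing.Theory Num.Theory.
Local Open Scope ring_scope.

Lemma binS2 k : 'C(k.+1, 2) = ('C(k, 2) + k)%N.
Proof. by rewrite binS bin1. Qed.

Lemma sqrn_bin2 k : (k ^ 2 = 'C(k, 2) * 2 + k)%N.
Proof. by have := mul_bin_diag k 1; rewrite bin1; case: k => // k /=; lia. Qed.

(** * Star sums as iterated sums *)

Section QHarmonic.
Context (R : fieldType) (q : R).

Fixpoint qHrec (n : nat) (s : seq int) : R :=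
  if s is e :: s' then
    \sum_(1 <= k < n.+1) q ^+ k / qnum q k ^ e * qHrec k s'
  else 1.

Definition dominated (n : nat) (k : seq nat) : bool :=
  path (fun x y => (y <= x)%N) n k && all (leq 1) k.

(** The ordinal bound [N] stays fixed while [n] varies, so the induction hypothesis applies to the
    tail with [n] replaced by the first index. *)
Lemma qHrec_tuple (N n : nat) (s : seq int) : (n <= N)%N ->
  \sum_(k : (size s).-tuple 'I_N.+1 | dominated n (map val k))
    \prod_(j < size s) (q ^+ tnth k j / qnum q (tnth k j) ^ s`_j)
  = qHrec n s.
Proof.
elim: s n => [|e s IHs] n le_nN /=.
  rewrite (big_pred1 [tuple]) ?big_ord0 // => k.
  by rewrite [k]tuple0 /= eqxx.
pose h (p : 'I_N.+1 * (size s).-tuple 'I_N.+1) : (size s).+1.-tuple 'I_N.+1 :=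
  [tuple of p.1 :: p.2].
rewrite (reindex h) /=; last first.
  exists (fun t => (thead t, [tuple of behead t])) => [[x t] _ | t _].
    by rewrite /h /= theadE; congr pair; apply: val_inj.
  by rewrite /h -tuple_eta.
pose F (x : nat) := q ^+ x / qnum q x ^ e.
pose G (t : (size s).-tuple 'I_N.+1) :=
  \prod_(j < size s) (q ^+ tnth t j / qnum q (tnth t j) ^ s`_j).
transitivity (\sum_(x < N.+1 | (1 <= x <= n)%N)
    \sum_(t : (size s).-tuple 'I_N.+1 | dominated x (map val t)) F x * G t).
  rewrite pair_big_dep /=; apply: eq_big => [[x t]|[x t] _] /=.
    rewrite /dominated /=.
    by rewrite andbACA [X in X && _ = _]andbC.
  rewrite big_ord_recl /= tnth0; congr (_ * _).
  by apply: eq_bigr => j _; rewrite tnthS.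
rewrite (eq_bigr (fun x : 'I_N.+1 => F x * qHrec x s)); last first.
  move=> x _; rewrite -big_distrr /=; congr (_ * _).
  by apply: IHs; rewrite -ltnS.
by rewrite big_geq_mkord
  (big_ord_widen_cond N.+1 (leq 1) (fun k => F k * qHrec k s)).
Qed.

Lemma qHstarE (n : nat) (s : seq int) : qHstar q n s = qHrec n s.
Proof.
rewrite -(qHrec_tuple s (leqnn n)); apply: eq_bigl => k.
rewrite /dominated all_map; congr (_ && _).
(* The first entry is at most [n] by its type, so starting the path at [n] adds no condition. *)
by case: (tval k) => //= x t; rewrite -ltnS ltn_ord /= path_map.
Qed.

(** * The ratio c(n,k) and its recurrences *)

Hypotheses (q_neq0 : q != 0) (qX_neq1 : forall k, (0 < k)%N -> q ^+ k != 1).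

Let subqX_neq0 k : (0 < k)%N -> 1 - q ^+ k != 0.
Proof. by move=> k_gt0; rewrite subr_eq0 eq_sym qX_neq1. Qed.

Let subq_neq0 : 1 - q != 0.
Proof. exact: (subqX_neq0 (k := 1)). Qed.

Lemma qpochS (n : nat) : qpoch q n.+1 = qpoch q n * (1 - q ^+ n.+1).
Proof. by rewrite /qpoch big_nat_recr. Qed.

Lemma qpoch_neq0 (n : nat) : qpoch q n != 0.
Proof.
elim: n => [|n IHn]; first by rewrite /qpoch big_nil oner_eq0.
by rewrite qpochS mulf_neq0 ?subqX_neq0.
Qed.

Lemma qnum_neq0 (n : nat) : (0 < n)%N -> qnum q n != 0.
Proof. by move=> n_gt0; rewrite mulf_neq0 ?invr_eq0 ?subqX_neq0. Qed.

Definition qratio (n k : nat) : R := qbin q n k / qbin q (n + k) k.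

Lemma qratio_small (n k : nat) : (n < k)%N -> qratio n k = 0.
Proof. by move=> lt_nk; rewrite /qratio /qbin leqNgt lt_nk /= mul0r. Qed.

Lemma qratioE (n k : nat) : (k <= n)%N ->
  qratio n k = qpoch q n ^+ 2 / (qpoch q (n - k) * qpoch q (n + k)).
Proof.
move=> le_kn; rewrite /qratio /qbin le_kn leq_addl addnK.
by field; rewrite !qpoch_neq0.
Qed.

Lemma qratio_recr (n k : nat) : (k <= n)%N ->
  qratio n k.+1 * (1 - q ^+ (n + k.+1)) = qratio n k * (1 - q ^+ (n - k)).
Proof.
rewrite leq_eqVlt => /predU1P[->|lt_kn].
  (* At [k = n] the left side vanishes through the ratio, the right through [1 - q ^+ 0]. *)
  by rewrite qratio_small // subnn expr0 subrr mul0r mulr0.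
rewrite !qratioE ?(ltnW lt_kn) // -(subnSK lt_kn) addnS !qpochS.
by field; rewrite !qpoch_neq0 !subqX_neq0.
Qed.

(** For k <= n and m = n+1, c(n,k)/c(m,k) = (1-q^{m-k})(1-q^{m+k})/(1-q^m)^2, and (1-q^m)^2 -
    (1-q^{m-k})(1-q^{m+k}) = q^{m-k}(1-q^k)^2. *)
Lemma qratio_recl (n k : nat) : (0 < k <= n.+1)%N ->
  qratio n.+1 k - qratio n k
  = q ^+ n.+1 / qnum q n.+1 ^+ 2 * (qnum q k ^+ 2 / q ^+ k * qratio n.+1 k).
Proof.
case/andP=> k_gt0; rewrite leq_eqVlt => /predU1P[->|].
  rewrite (qratio_small (ltnSn n)) subr0; field.
  by rewrite expf_neq0 // qnum_neq0.
rewrite ltnS => le_kn; rewrite !qratioE ?leqW // subSn // addSn !qpochS.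
have := (qpoch_neq0 n, qpoch_neq0 (n - k), qpoch_neq0 (n + k)).
have := (subqX_neq0 (ltn0Sn n), subqX_neq0 (ltn0Sn (n - k))).
have := (subqX_neq0 (ltn0Sn (n + k)), expf_neq0 k q_neq0, subq_neq0).
rewrite /qnum; have -> : q ^+ n.+1 = q ^+ (n - k).+1 * q ^+ k.
  by rewrite -exprD addSn subnK.
have -> : q ^+ (n + k).+1 = q ^+ (n - k).+1 * q ^+ k ^+ 2.
  by rewrite -exprM -exprD; congr (_ ^+ _); lia.
move: (q ^+ k) (q ^+ (n - k).+1) (qpoch _ _) (qpoch _ _) (qpoch _ _).
move=> x y u v w [[nz1 nz2] nz3] [nz4 nz5] [[nz6 nz7] nz8].
by field; do ?[apply/andP; split].
Qed.

Lemma qratio_sum_recl (D : nat -> R) (n : nat) :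
  \sum_(1 <= k < n.+2) D k * qratio n.+1 k
  - \sum_(1 <= k < n.+1) D k * qratio n k
  = q ^+ n.+1 / qnum q n.+1 ^+ 2
    * \sum_(1 <= k < n.+2) D k * (qnum q k ^+ 2 / q ^+ k) * qratio n.+1 k.
Proof.
(* Since c(n,n+1) = 0, both sums may run over the same range. *)
have -> : \sum_(1 <= k < n.+1) D k * qratio n k =
          \sum_(1 <= k < n.+2) D k * qratio n k.
  by rewrite [RHS]big_nat_recr //= qratio_small ?mulr0 ?addr0.
rewrite -sumrB mulr_sumr; apply: eq_big_nat => k k_bnd.
rewrite -mulrBr qratio_recl //.
by rewrite [LHS]mulrCA [in LHS](mulrA (D k)).
Qed.

(** Both sides vanish at n = 0; the hypothesis, with denominators cleared, says that their
    increments agree. *)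
Lemma qHrec_cons (e : int) (s : seq int) (D : nat -> R) :
  (forall n, (0 < n)%N -> qnum q n ^+ 2 * qHrec n s =
     qnum q n ^ e *
     \sum_(1 <= k < n.+1) D k * (qnum q k ^+ 2 / q ^+ k) * qratio n k) ->
  forall n, qHrec n (e :: s) = \sum_(1 <= k < n.+1) D k * qratio n k.
Proof.
move=> Ds; elim=> [|n IHn]; first by rewrite /= !big_geq.
have nz := @qnum_neq0 n.+1 isT.
have nze : qnum q n.+1 ^ e != 0 by rewrite expfz_neq0.
rewrite /= big_nat_recr //= [X in X + _]IHn.
rewrite -[RHS](subrK (\sum_(1 <= k < n.+1) D k * qratio n k)) qratio_sum_recl addrC.
congr (_ + _); move: (Ds n.+1 isT); move: nze.
move: (_ ^ e) (qHrec _ _) (\sum_(_ <= _ < _) _) => y h S nze /(canRL (mulKf _)) ->.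
  by field; rewrite nz nze.
by rewrite expf_neq0.
Qed.

(** * Telescoping sums in k *)

Lemma qratio_shift (n k : nat) : (k <= n)%N ->
  [/\ q ^+ n = q ^+ (n - k) * q ^+ k,
      q ^+ (n + k) = q ^+ (n - k) * q ^+ k ^+ 2 &
      qratio n k.+1 * (1 - q ^+ (n + k.+1)) = qratio n k * (1 - q ^+ (n - k))].
Proof.
move=> le_kn; split; last exact: qratio_recr.
  by rewrite -exprD subnK.
by rewrite -exprM -exprD; congr (_ ^+ _); lia.
Qed.

(** The case k = 0 of [qratio_recr], where c(n,0) = 1; it evaluates the telescoping sums at their
    lower end. *)
Lemma qratio_edge (n : nat) : qratio n 1 * (1 - q ^+ n.+1) = 1 - q ^+ n.
Proof.
rewrite -[n.+1 in LHS]addn1 (qratio_recr (leq0n n)) subn0 qratioE // subn0 addn0.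
by rewrite expr2 divff ?mul1r // mulf_neq0 ?qpoch_neq0.
Qed.

Lemma alternating_qratio_sum (n : nat) : (0 < n)%N ->
  \sum_(1 <= k < n.+1) (1 + q ^+ k) * (-1) ^+ k * q ^+ 'C(k, 2) * qratio n k
  = -1.
Proof.
move=> n_gt0; have nz := subqX_neq0 n_gt0.
(* By [qratio_recr], [f k.+1 - f k] acquires the factor q^k(1-q^{n-k}) + 1 - q^{n+k} =
   (1+q^k)(1-q^n). At the ends, [f n.+1 = 0] and [f 1 = 1]. *)
pose f k :=
  - ((-1) ^+ k * (qratio n k * (1 - q ^+ (n + k))) * q ^+ 'C(k, 2) / (1 - q ^+ n)).
rewrite (telescope_sumr_eq f) // => [|k /andP[_]].
  rewrite /f qratio_small // mul0r mulr0 !mul0r addn1 qratio_edge.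
  by rewrite expr0 expr1; field.
rewrite ltnS => /qratio_shift[En Enk Ec].
rewrite /f Ec binS2 exprS exprD; rewrite {}En {}Enk {Ec} in nz *.
by field.
Qed.

Lemma quadratic_qratio_sum (n : nat) :
  \sum_(1 <= k < n.+1) (1 + q ^+ k) * qnum q k * q ^+ 'C(k, 2) ^+ 2 * qratio n k
  = qnum q n.
Proof.
(* Here the factor is 1 - q^{n+k} - q^{2k}(1-q^{n-k}) = (1-q^k)(1+q^k), and [f 1 = - qnum q n]. *)
pose f k := - (qratio n k * (1 - q ^+ (n + k)) * q ^+ 'C(k, 2) ^+ 2 / (1 - q)).
rewrite (telescope_sumr_eq f) // => [|k /andP[_]].
  rewrite /f qratio_small // !mul0r addn1 qratio_edge /qnum.
  by rewrite expr0; field.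
rewrite ltnS => /qratio_shift[_ Enk Ec].
rewrite /f Ec /qnum binS2 exprD Enk.
by field.
Qed.

(** * Expansions of the star sums *)

Lemma qHrec_nseq2 (s : seq int) (A : nat -> R) (a : nat) :
  (forall n, (0 < n)%N -> qHrec n s = \sum_(1 <= k < n.+1) A k * qratio n k) ->
  forall n, (0 < n)%N -> qHrec n (nseq a 2%:Z ++ s) =
    \sum_(1 <= k < n.+1) A k * (q ^+ k / qnum q k ^+ 2) ^+ a * qratio n k.
Proof.
move=> sA; elim: a => [|a IHa] n n_gt0.
  by rewrite sA //; apply: eq_bigr => k _; rewrite expr0 mulr1.
(* For e = 2 it suffices that multiplying the new coefficient by [k]^2/q^k restores the old one. *)
apply: qHrec_cons => {n_gt0}n n_gt0; rewrite IHa //; congr (_ * _).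
apply: eq_big_nat => k /andP[k_gt0 _]; congr (_ * _).
rewrite [_ ^+ a.+1]exprSr; move: (_ ^+ a) => y.
by field; rewrite expf_neq0 // qnum_neq0.
Qed.

Lemma qHrec_2 (a n : nat) : (0 < n)%N ->
  qHrec n (nseq a 2%:Z) =
  \sum_(1 <= k < n.+1) - ((1 + q ^+ k) * (-1) ^+ k * q ^+ 'C(k, 2))
    * (q ^+ k / qnum q k ^+ 2) ^+ a * qratio n k.
Proof.
move=> n_gt0; rewrite -[nseq _ _]cats0.
apply: (qHrec_nseq2 (A := fun k => - ((1 + q ^+ k) * (-1) ^+ k * q ^+ 'C(k, 2))))
  => // {n_gt0}n n_gt0.
apply: oppr_inj; rewrite -[LHS](alternating_qratio_sum n_gt0) -sumrN.
by apply: eq_bigr => k _; rewrite mulNr opprK.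
Qed.

(** With e = 1 and an empty tail, the criterion of [qHrec_cons] is [quadratic_qratio_sum] multiplied
    by [n]. *)
Lemma qHrec_1 (n : nat) :
  qHrec n [:: 1%:Z] =
  \sum_(1 <= k < n.+1) (1 + q ^+ k) / qnum q k * q ^+ (k ^ 2) * qratio n k.
Proof.
apply: qHrec_cons => {}n n_gt0.
rewrite mulr1 expr1z expr2; congr (_ * _); rewrite -[LHS]quadratic_qratio_sum.
apply: eq_big_nat => k /andP[k_gt0 _]; congr (_ * _).
rewrite sqrn_bin2 exprD exprM; field.
by rewrite qnum_neq0 // expf_neq0.
Qed.

(** The inner summand of the third formula: as j(j+1)/2 = C(j,2) + j, its integer power of [q]
    becomes a quotient of natural powers. *)
Definition innerterm (b j : nat) : R :=
  (-1) ^+ j * (1 + q ^+ j) * (q ^+ j) ^+ b / (q ^+ j * q ^+ 'C(j, 2))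
  / qnum q j ^+ (2 * b).

(** Once [qHrec_2] expands the tail, the criterion with e = 1 asks that [n] times that single sum
    equal the new sum weighted by [k]^2/q^k. *)
Lemma qHrec_1_2 (b n : nat) :
  qHrec n (1%:Z :: nseq b 2%:Z) =
  \sum_(1 <= k < n.+1)
    - ((1 + q ^+ k) / qnum q k ^+ (2 * b).+1 * (-1) ^+ k
         * (q ^+ 'C(k, 2) * q ^+ k * (q ^+ k) ^+ b)
       + (1 + q ^+ k) / qnum q k * (q ^+ 'C(k, 2) ^+ 2 * q ^+ k)
         * \sum_(1 <= j < k) innerterm b j)
    * qratio n k.
Proof.
apply: qHrec_cons => {}n n_gt0; rewrite expr1z expr2 -mulrA; congr (_ * _).
rewrite qHrec_2 // mulr_sumr; apply/eqP; rewrite -subr_eq0 -sumrB.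
(* [f k - f k.+1] yields both the double sum and, through the last term of its
   inner sum, the part of the single sum needed to recover [[n] H*_n[{2}^b]]. *)
pose f k := qratio n k * (1 - q ^+ (n + k)) * q ^+ 'C(k, 2) ^+ 2 / (1 - q)
            * \sum_(1 <= j < k) innerterm b j.
rewrite (telescope_sumr_eq (fun k => - f k)) // => [|k /andP[k_gt0]].
  (* [f] vanishes at both ends: at n+1 through the ratio, at 1 because the inner sum is empty. *)
  by rewrite /f qratio_small // !mul0r [X in _ * X]big_geq // mulr0 subrr.
have := qnum_neq0 k_gt0; rewrite ltnS => nz /qratio_shift[En Enk Ec].
rewrite /f Ec big_nat_recr //= binS2 exprD.
move: (\sum_(_ <= _ < _) _) => S.
rewrite /innerterm [_ ^+ (2 * b).+1]exprS exprM expr_div_n.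
move: (qratio n k) (expf_neq0 b (expf_neq0 2 nz)) => c.
rewrite /qnum Enk En; have := (subqX_neq0 k_gt0, expf_neq0 'C(k, 2) q_neq0).
move: (expf_neq0 k q_neq0) ((-1) ^+ k) (q ^+ k ^+ b) (_ ^+ b).
move: (q ^+ k) (q ^+ 'C(k, 2)) (q ^+ (n - k)).
move=> x t z nzx e u v [nz1 nzt] nzv.
by field; do ?[apply/andP; split].
Qed.
End QHarmonic.

Theorem theorem3p1 (R : realFieldType) (q : R) (hq0 : 0 < q) (hq1 : q < 1)
    (a b : nat) (hb : (1 <= b)%N) (n : nat) (hn : (1 <= n)%N) :
  [/\ qHstar q n (nseq a 2%:Z) =
        \sum_(1 <= k < n.+1)
          (1 + q ^+ k) / qnum q k ^+ (2 * a)
          * (qbin q n k / qbin q (n + k) k)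
          * (-1) ^+ (k - 1) * q ^+ ((k * (k - 1)) %/ 2 + a * k),
      qHstar q n (nseq a 2%:Z ++ [:: 1%:Z]) =
        \sum_(1 <= k < n.+1)
          (1 + q ^+ k) / qnum q k ^+ (2 * a + 1)
          * (qbin q n k / qbin q (n + k) k)
          * q ^+ (k ^ 2 + a * k)
    & qHstar q n (nseq a 2%:Z ++ [:: 1%:Z] ++ nseq b 2%:Z) =
        - (\sum_(1 <= k < n.+1)
             (1 + q ^+ k) / qnum q k ^+ (2 * (a + b) + 1)
             * (qbin q n k / qbin q (n + k) k)
             * (-1) ^+ k * q ^+ ((k * (k + 1)) %/ 2 + (a + b) * k))
        - \sum_(1 <= k < n.+1)
            (1 + q ^+ k) / qnum q k ^+ (2 * a + 1)
            * (qbin q n k / qbin q (n + k) k)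
            * q ^+ (k ^ 2 + a * k)
            * \sum_(1 <= j < k)
                (-1) ^+ j * (1 + q ^+ j)
                * q ^ ((b * j)%N%:Z - ((j * (j + 1)) %/ 2)%N%:Z)
                / qnum q j ^+ (2 * b)].
Proof.
have q_neq0 : q != 0 by rewrite gt_eqF.
have qX_neq1 k : (0 < k)%N -> q ^+ k != 1.
  by move=> k_gt0; rewrite lt_eqF // exprn_ilt1 ?ltW // -lt0n.
have half_bin k : ((k * (k - 1)) %/ 2 = 'C(k, 2))%N.
  by rewrite bin2 subn1 divn2.
have half_binS k : ((k * (k + 1)) %/ 2 = 'C(k, 2) + k)%N.
  by rewrite -binS2 bin2 /= addn1 mulnC divn2.
have Xe k m c : q ^+ (c + m * k) = q ^+ c * (q ^+ k) ^+ m.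
  by rewrite exprD mulnC exprM.
split; rewrite qHstarE.
- rewrite qHrec_2 //; apply: eq_big_nat => k /andP[k_gt0 _].
  rewrite -/(qratio q n k) half_bin Xe exprM expr_div_n.
  (* The minus sign of the expansion is absorbed into [(-1) ^+ (k - 1)], which relies on [k > 0]. *)
  have -> : (-1) ^+ k = - (-1) ^+ (k - 1) :> R.
    by case: k k_gt0 => // k _; rewrite subn1 exprS mulN1r.
  by ring.
- rewrite (qHrec_nseq2 q_neq0 qX_neq1 a (fun n _ => qHrec_1 q_neq0 qX_neq1 n)) //.
  apply: eq_big_nat => k /andP[k_gt0 _].
  rewrite -/(qratio q n k) Xe addn1 [_ ^+ (2 * a).+1]exprS exprM expr_div_n.
  rewrite [(qnum q k * _)^-1]invfM.
  by ring.
rewrite (qHrec_nseq2 q_neq0 qX_neq1 a (fun n _ => qHrec_1_2 q_neq0 qX_neq1 b n)) //.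
rewrite -opprD -big_split -sumrN; apply: eq_big_nat => k /andP[k_gt0 _] /=.
have -> : \sum_(1 <= j < k) (-1) ^+ j * (1 + q ^+ j)
                * q ^ ((b * j)%N%:Z - ((j * (j + 1)) %/ 2)%N%:Z)
                / qnum q j ^+ (2 * b) = \sum_(1 <= j < k) innerterm q b j.
  apply: eq_bigr => j _; rewrite /innerterm half_binS expfzDr // -exprnP -exprnN.
  by rewrite [(b * j)%N]mulnC exprM [('C(_, _) + _)%N]addnC exprD !mulrA.
rewrite -/(qratio q n k) half_binS !Xe sqrn_bin2.
rewrite !(exprD q) (exprM q) (exprD (q ^+ k)).
move: (qnum q k) (\sum_(_ <= _ < _) _) => N S.
(* Powers of [k] are split into [k], [k]^{2a} and [k]^{2b}, so that [ring] finds the same inverses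
   on both sides. *)
rewrite !addn1 !(exprS N (2 * _)) mulnDr.
rewrite (exprD N) !(exprM N) (expr_div_n _ (N ^+ 2)).
rewrite ![(N * _)^-1]invfM [(N ^+ 2 ^+ a * _)^-1]invfM.
by ring.
Qed.
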